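(* Let $d\ge 1$ and $n\ge 1$ be integers, and let $H=(V,E)$ be a $d$-interval hypergraph. Assume that every $d\times n$-partition of $V$ has a $d$-cell that is contained in an edge of $H$. Then there exists a $d\times n$-partition of $V$ all of whose cells are contained in edges of $H_0$, where $H_0$ is a subhypergraph of $H$ (i.e. a subset $E_0\subseteq E$ of edges) of size $|E_0|\le (1+\ln d)n$. In particular, $\rho(H)\le (1+\ln d)n$. Moreover, for $d=2$ the upper bound on the size of $H_0$ can be improved to $n$, and hence $\rho(H)\le n$ when $d=2$.
   Context: A $d$-interval hypergraph $H=(V,E)$ has vertex set $V=\bigcup_{i=1}^d U^i$, where $U^1,\dots,U^d$ are $d$ disjoint copies of the unit interval $[0,1]$, and a finite edge set $E$, each edge being of the form $e=\bigcup_{i=1}^d I^i$ with $I^i$ a non-empty closed subinterval of $U^i$. An $n$-partition of $[0,1]$ is a system of $n$ subintervals $[0,c_1),(c_1,c_2),\dots,(c_{n-2},c_{n-1}),(c_{n-1},1]$ where $0\le c_1\le c_2\le\dots\le c_{n-1}\le 1$; these are the first, ..., $n$-th cells (the $j$-th cell is empty if $c_{j-1}=c_j$, with $c_0=0$, $c_n=1$). A $d\times n$-partition of $V$ consists of $d$ $n$-partitions of $U^1,\dots,U^d$ respectively (so $dn$ cells in total). A $d$-cell is any union of $d$ cells, one from the partition of each $U^i$. The edge-covering number $\rho(H)$ is the minimal number of edges whose union is $V$ ($\rho(H)=\infty$ if $\bigcup E\ne V$). *)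

(* Defs.v *)
From HB Require Import structures.
From mathcomp Require Import all_boot all_order all_algebra.
From mathcomp Require Import finmap.
From mathcomp Require Import all_classical all_reals all_analysis.
Set Implicit Arguments.
Unset Strict Implicit.
Unset Printing Implicit Defensive.
Import Order.TTheory GRing.Theory Num.Theory.
Local Open Scope classical_set_scope.
Local Open Scope ring_scope.

Section DIntervals.
Variables (R : realType) (d : nat).

(* A point of the i-th copy of a subset of R is a pair (i, x). *)
Definition copy (i : 'I_d) (A : set R) : set ('I_d * R) := [set i] `*` A.

Definition ground : set ('I_d * R) := \bigcup_(i in setT) copy i `[0, 1].

Definition is_dinterval (e : set ('I_d * R)) : Prop :=
  exists a b : 'I_d -> R,
    (forall i, [/\ 0 <= a i, a i <= b i & b i <= 1]) /\
    e = \bigcup_(i in setT) copy i `[a i, b i].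

Record dinterval_hypergraph := DIntervalHypergraph {
  edges : {fset set ('I_d * R)};
  edges_dinterval : forall e, e \in edges -> is_dinterval e
}.

Definition covers (F : {fset set ('I_d * R)}) : Prop :=
  \bigcup_(e in [set` F]) e = ground.

(* The infimum of the empty set is +oo. *)
Definition edge_covering_number (H : dinterval_hypergraph) : \bar R :=
  ereal_inf [set (#|` F|%:R)%:E | F in
    [set F : {fset set ('I_d * R)} | (F `<=` edges H)%fset /\ covers F]].

End DIntervals.

Section Partitions.
Variables (R : realType) (d n : nat).

(* The cut points c_0 = 0 <= c_1 <= ... <= c_n = 1. *)
Record npartition := NPartition {
  cutpt :> 'I_n.+1 -> R;
  cutpt_first : cutpt ord0 = 0;
  cutpt_last : cutpt ord_max = 1;
  cutpt_le : forall j k : 'I_n.+1, (j <= k)%N -> cutpt j <= cutpt k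
}.

(* The j-th cell, j = 0, ..., n - 1, lies between c_j and c_(j+1): it is open at
   both ends, except closed at 0 for the first cell and at 1 for the last one
   (so the only cell is [0, 1] when n = 1). *)
Definition cell (c : npartition) (j : 'I_n) : set R :=
  [set x | c (widen_ord (leqnSn n) j) < x ?<= if (j == 0%N :> nat) /\
           x < c (lift ord0 j) ?<= if (j.+1 == n)].

Definition dcell (P : 'I_d -> npartition) (f : 'I_d -> 'I_n) :
    set ('I_d * R) :=
  \bigcup_(i in setT) copy i (cell (P i) (f i)).

Definition cells_in_edges (P : 'I_d -> npartition)
    (F : {fset set ('I_d * R)}) : Prop :=
  forall (i : 'I_d) (j : 'I_n),
    exists2 e, e \in F & copy i (cell (P i) j) `<=` e.

End Partitions.

(* Main.v *)
(* A choice of one cell in each copy is a vertex of a product of [d] simplices of dimension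
   [n - 1], and the d x n-partitions are the points [x] of this product, [x i j] being the
   length of the [j]-th cell of the [i]-th copy. The hypothesis gives each [x] a d-cell
   lying in an edge, in which moreover any empty cell may be substituted. A Brouwer fixed
   point argument (a partition of unity subordinate to the closed conditions "this d-cell
   lies in this edge", followed by a compactness argument) then yields a partition [x]
   and nonnegative weights on the d-cells lying in edges such that every cell has total
   weight [1]: a fractional perfect matching of weight [n] in a [d]-partite hypergraph.
   The greedy algorithm turns it into a cover by at most [(1 + 1/2 + ... + 1/d) n] d-cells,
   and for [d = 2] Hall's theorem turns it into a perfect matching with [n] edges.

   Brouwer's theorem on a simplex is deduced from Scarf's lemma on finitely many linear
   orders on a finite set, which is proved by counting modulo 2 the incidences between
   "rooms" and "doors". *)
Require Import Defs.
From mathcomp Require Import all_boot.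
From mathcomp Require Import zify.
Set Implicit Arguments.
Unset Strict Implicit.
Unset Printing Implicit Defensive.

(** * Scarf's lemma and Hall's theorem *)

Lemma card_redundant (S R : finType) (f : S -> R) (X : {set S}) (Y : {set R}) :
  f @: X = Y -> #|X| = #|Y|.+1 -> (0 < #|Y|)%N ->
  #|[set s in X | f @: (X :\ s) == Y]| = 2.
Proof.
move=> fXY cX Y0.
have /dinjectivePn[i1 i1X [i2 /andP[i21 i2X] e12]] : ~~ dinjectiveb f X.
  by apply/negP => /dinjectiveP/card_in_imset; rewrite fXY cX; lia.
rewrite /= in i21 i2X.
suff -> : [set s in X | f @: (X :\ s) == Y] = [set i1; i2].
  by rewrite cards2 eq_sym i21.
have drop s t : s \in X -> t \in X -> s != t -> f s = f t -> f @: (X :\ s) = Y.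
  move=> sX tX st est; apply/eqP; rewrite eqEsubset -fXY imsetS ?subD1set //=.
  apply/subsetP => _ /imsetP[k kX ->].
  have [->|ks] := eqVneq k s; first by rewrite est imset_f// !inE eq_sym st.
  by rewrite imset_f// !inE ks.
apply/setP => s; rewrite !inE; apply/andP/orP; last first.
  case=> /eqP->; split=> //; apply/eqP; last exact: drop i21 (esym e12).
  by apply: drop e12 => //; rewrite eq_sym.
case=> sX /eqP fs; apply/orP; apply/negPn/negP; rewrite negb_or => /andP[s1 s2].
have : f @: (X :\ s :\ i1) = Y.
  apply/eqP; rewrite eqEsubset -{1}fXY imsetS ?(subset_trans (subD1set _ _)) ?subD1set//=.
  rewrite -fs; apply/subsetP => _ /imsetP[k kX ->].
  have [->|ks] := eqVneq k i1; last by rewrite imset_f// !inE ks; rewrite !inE in kX.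
  by rewrite e12 imset_f// !inE i21 eq_sym s2.
move=> /(congr1 (fun Z : {set R} => #|Z|)).
have := leq_imset_card f (X :\ s :\ i1).
have := cardsD1 i1 (X :\ s); have := cardsD1 s X.
by rewrite sX !inE eq_sym s1 i1X /=; lia.
Qed.

Section Scarf.
Variables (T I : finType) (r : I -> T -> nat).
Hypothesis r_inj : forall i, injective (r i).
Variable t0 : T.

(** Scarf's dominance: no point of [T] lies strictly above the minima of [A] in all the orders of
    [C] at once. *)
Definition dominant (A : {set T}) (C : {set I}) : bool :=
  [forall y, exists i in C, forall x in A, r i y <= r i x].

Lemma dominantP (A : {set T}) (C : {set I}) :
  reflect (forall y, exists2 i, i \in C & forall x, x \in A -> r i y <= r i x)
          (dominant A C).
Proof.
apply: (iffP forallP) => h y; first by have /exists_inP[i iC /forall_inP] := h y; exists i.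
by have [i iC hi] := h y; apply/exists_inP; exists i => //; apply/forall_inP.
Qed.

Lemma sub_dominant (A A' : {set T}) (C C' : {set I}) :
  A' \subset A -> C \subset C' -> dominant A C -> dominant A' C'.
Proof.
move=> /subsetP sA /subsetP sC /dominantP h; apply/dominantP => y.
by have [i iC hi] := h y; exists i; [exact: sC | move=> x /sA/hi].
Qed.

(** For empty [A] this is the default [t0]. *)
Definition rank_min (A : {set T}) (k : I) : T := [arg min_(b < odflt t0 [pick x in A] in A) r k b].

Lemma rank_minP (A : {set T}) k a : a \in A ->
  rank_min A k \in A /\ forall b, b \in A -> r k (rank_min A k) <= r k b.
Proof.
move=> aA; rewrite /rank_min; case: pickP => [x xA|/(_ a)]; last by rewrite aA.
by case: arg_minnP.
Qed.

Lemma rank_min_eq (A : {set T}) k a :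
  a \in A -> (forall b, b \in A -> r k a <= r k b) -> rank_min A k = a.
Proof.
move=> aA ha; have [mA hm] := rank_minP k aA.
by apply: (@r_inj k); apply/eqP; rewrite eqn_leq hm ?ha.
Qed.

(** Dominance tested on a point of [A] itself makes that point the minimum of [A] in some order of
    [C]. *)
Lemma dominant_rank_min (A : {set T}) (C : {set I}) a :
  a \in A -> dominant A C -> rank_min A @: C = A.
Proof.
move=> aA /dominantP h; apply/eqP; rewrite eqEsubset; apply/andP; split.
  by apply/subsetP => _ /imsetP[k kC ->]; have [] := rank_minP k aA.
apply/subsetP => x xA; have [i iC hi] := h x.
by apply/imsetP; exists i => //; rewrite (rank_min_eq xA hi).
Qed.

(** * The rooms behind a door *)

Section Door.
Variables (B : {set T}) (D : {set I}).
Hypotheses (domBD : dominant B D) (cardD : #|D| = #|B|.+1).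

(** The points whose addition to [B] leaves its minimum unchanged in every order of [D] other than
    [i]. *)
Definition beyond (i : I) : {set T} := [set y | [forall k in D :\ i, r k (rank_min B k) < r k y]].

Lemma beyondP i y :
  reflect (forall k, k \in D -> k != i -> r k (rank_min B k) < r k y) (y \in beyond i).
Proof.
rewrite inE; apply: (iffP forall_inP) => h k; first by move=> kD ki; apply: h; rewrite !inE ki.
by rewrite !inE => /andP[ki kD]; apply: h.
Qed.

(** Scarf's pivot step: add the point of [beyond i] that is highest for [r i], or, if there is none,
    drop the order [i], which is what [inr i] encodes. *)
Definition pivot (i : I) : T + I :=
  if [pick y in beyond i] is Some y0 then inl [arg max_(y > y0 in beyond i) r i y] else inr i.

Lemma pivot_inl i x : x \in beyond i -> (forall y, y \in beyond i -> r i y <= r i x) ->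
  pivot i = inl x.
Proof.
move=> xM hx; rewrite /pivot; case: pickP => [y0 y0M|/(_ x)]; last by rewrite xM.
case: arg_maxnP => // z zM hz; congr inl; apply: (@r_inj i); apply/eqP.
by rewrite eqn_leq hx //; apply: hz.
Qed.

(** Only the order [i] can witness dominance at [x], since [x] exceeds the minimum of [B] in the
    others. *)
Lemma beyond_le i x b : x \in beyond i -> b \in B -> r i x <= r i b.
Proof.
move=> /beyondP xM bB; have /dominantP/(_ x)[k kD hk] := domBD.
have [ki|/(xM _ kD)] := eqVneq k i; first by rewrite -ki hk.
by rewrite ltnNge hk //; have [] := rank_minP k bB.
Qed.

(* An order [i] is redundant when dropping it leaves every point of [B] minimal for some
   remaining order; there are two such orders unless [B] is empty, and each gives one of
   the rooms behind the door. *)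
Definition redundant : {set I} := [set i in D | rank_min B @: (D :\ i) == B].

Lemma beyond_notin i x : i \in redundant -> x \in beyond i -> x \notin B.
Proof.
rewrite inE => /andP[_ /eqP mB] /beyondP xM; apply/negP; rewrite -mB => /imsetP[k].
by rewrite !inE => /andP[ki kD] xk; have := xM _ kD ki; rewrite xk ltnn.
Qed.

Definition extends (z : T + I) : bool :=
  match z with
  | inl x => (x \notin B) && dominant (x |: B) D
  | inr i => (i \in D) && dominant B (D :\ i)
  end.

(** Points of [beyond i] are handled in the order [i] by maximality of the pivot; any other point is
    below the minimum of [B] in some other order, and that minimum is unchanged. *)
Lemma pivot_extends i : i \in redundant -> extends (pivot i).
Proof.
move=> iX; have iD : i \in D by move: iX; rewrite inE => /andP[].
rewrite /pivot; case: pickP => [y0 y0M|M0] /=.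
  case: arg_maxnP => // x xM hx; rewrite (beyond_notin iX xM) /=.
  apply/dominantP => y; have [yM|] := boolP (y \in beyond i).
    exists i => // b; rewrite !inE => /orP[/eqP->|]; [exact: hx|exact: beyond_le].
  rewrite inE negb_forall_in => /exists_inP[k]; rewrite !inE -leqNgt => /andP[ki kD] yk.
  exists k => // b; rewrite !inE => /orP[/eqP->|bB].
    by apply: (leq_trans yk); apply: ltnW; move/beyondP: xM => ->.
  by apply: (leq_trans yk); have [_ ->] := rank_minP k bB.
rewrite iD; apply/dominantP => y; have := M0 y; rewrite inE => /negbT.
rewrite negb_forall_in => /exists_inP[k kD]; rewrite -leqNgt => yk; exists k => // b bB.
by apply: (leq_trans yk); have [_ ->] := rank_minP k bB.
Qed.

(** There are now as many points as orders, so distinct orders have distinct minima and [x] is the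
    minimum in a single order [i]. The other minima stay in [B], hence [x] is beyond [i], and
    dominance makes it the highest such point. *)
Lemma extends_inl x : x \notin B -> dominant (x |: B) D ->
  {in D &, injective (rank_min (x |: B))} /\
  exists2 i, i \in redundant & rank_min (x |: B) i = x /\ pivot i = inl x.
Proof.
move=> xB dA; set A := x |: B; have xA : x \in A by rewrite !inE eqxx.
have mA := dominant_rank_min xA dA.
have inj : {in D &, injective (rank_min A)}.
  by apply/imset_injP; rewrite mA cardsU1 xB cardD.
split=> //; have : x \in rank_min A @: D by rewrite mA.
case/imsetP => i iD xi.
have muA k : k \in D -> k != i -> rank_min A k \in B /\ rank_min B k = rank_min A k.
  move=> kD ki; have [mkA hk] := rank_minP k xA.
  have mkB : rank_min A k \in B.
    move: mkA; rewrite !inE => /orP[/eqP mkx|//]; move: ki.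
    by rewrite (inj k i) ?eqxx// mkx.
  by split=> //; apply: rank_min_eq => // b bB; apply: hk; rewrite !inE bB orbT.
have xM : x \in beyond i.
  apply/beyondP => k kD ki; have [mB ->] := muA k kD ki.
  rewrite ltn_neqAle; have [_ ->//] := rank_minP k xA; rewrite andbT.
  by rewrite (inj_eq (@r_inj k)); apply: contraNneq xB => <-.
have iX : i \in redundant.
  rewrite inE iD; apply/eqP/setP => b; apply/imsetP/idP.
    by move=> [k]; rewrite !inE => /andP[ki kD] ->; have [mB ->] := muA k kD ki.
  move=> bB; have : b \in rank_min A @: D by rewrite mA !inE bB orbT.
  case/imsetP => k kD bk; have ki : k != i.
    by apply: contraNneq xB => ki; rewrite xi -ki -bk.
  by exists k; rewrite ?inE ?ki//; have [_ ->] := muA k kD ki.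
exists i => //; split=> //; apply: pivot_inl => // y /beyondP yM.
have [k kD hk] := dominantP _ _ dA y.
have [ki|ki] := eqVneq k i; first by rewrite -ki hk.
have [mB mBk] := muA k kD ki; have := yM k kD ki.
by rewrite ltnNge mBk hk// !inE mB orbT.
Qed.

Lemma extends_pivot z : extends z -> exists2 i, i \in redundant & z = pivot i.
Proof.
case: z => [x /andP[xB dA]|i /andP[iD dB]].
  by have [_ [i iX [_ <-]]] := extends_inl xB dA; exists i.
(* Dominance at [t0] shows that [D :\ i] is nonempty, hence so is [B]. *)
have [k0 k0D _] := dominantP _ _ dB t0.
have cB : #|D :\ i| = #|B| by have := cardsD1 i D; rewrite iD cardD; lia.
have /card_gt0P[b bB] : (0 < #|B|)%N by rewrite -cB; apply/card_gt0P; exists k0.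
exists i; first by rewrite inE iD (dominant_rank_min bB dB) eqxx.
rewrite /pivot; case: pickP => // y /beyondP yM.
have [k] := dominantP _ _ dB y; rewrite !inE => /andP[ki kD] /(_ (rank_min B k)).
by have [mB _] := rank_minP k bB => /(_ mB); rewrite leqNgt yM.
Qed.

(** A point that is the pivot of two orders is the minimum of the enlarged set in both, and distinct
    orders have distinct minima there. *)
Lemma pivot_inj : {in redundant &, injective pivot}.
Proof.
move=> i j iX jX ep; have := pivot_extends iX; have := pivot_extends jX.
rewrite -ep.
have pE k : pivot k = inr k \/ exists2 x, pivot k = inl x & x \in beyond k.
  rewrite /pivot; case: pickP => [y0 y0M|_]; last by left.
  by right; case: arg_maxnP => // x xM _; exists x.
have [ei|[x ei xi]] := pE i; have [ej|[y ej yj]] := pE j.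
- by move: ep; rewrite ei ej => -[].
- by move: ep; rewrite ei ej.
- by move: ep; rewrite ei ej.
move: ep; rewrite ei ej => -[xy]; subst y => /= /andP[xB dA] _.
have [inj _] := extends_inl xB dA.
have xA : x \in x |: B by rewrite !inE eqxx.
have m k : x \in beyond k -> rank_min (x |: B) k = x.
  move=> xk; apply: (rank_min_eq xA) => b; rewrite !inE => /orP[/eqP->//|]; exact: beyond_le.
move: iX jX; rewrite !inE => /andP[iD _] /andP[jD _].
by apply: inj; rewrite ?m.
Qed.

Lemma card_extends : #|[set z | extends z]| = #|redundant|.
Proof.
rewrite -(card_in_imset pivot_inj); apply: eq_card => z; rewrite inE; apply/idP/imsetP.
  by case/extends_pivot => i iX ->; exists i.
by case=> i iX ->; exact: pivot_extends.
Qed.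

End Door.

(** * Counting incidences modulo 2 *)

Section Parity.
Variables (c : T -> I) (i0 : I).

(* A pair [(A, C)] of points and orders is encoded as a subset of [T + I] consisting of
   [A] and of the complement of [C]: it is a room when it has [#|I|] elements and is
   dominant, and its doors are obtained by removing one element. *)
Definition real_part (s : {set T + I}) : {set T} := [set x | inl x \in s].
Definition orders (s : {set T + I}) : {set I} := [set i | inr i \notin s].
Definition color (z : T + I) : I := match z with inl x => c x | inr i => i end.
Definition room (s : {set T + I}) : bool :=
  dominant (real_part s) (orders s) && (#|real_part s| == #|orders s|).
Definition flag (s : {set T + I}) (z : T + I) : bool :=
  [&& z \in s, room s & color @: (s :\ z) == ~: [set i0]].

Lemma card_real_part (s : {set T + I}) : #|s| + #|orders s| = #|real_part s| + #|I|.
Proof.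
have -> : #|s| = #|real_part s| + #|~: orders s|.
  rewrite -(card_imset (real_part s) (@inl_inj T I)) -(card_imset (~: orders s) (@inr_inj T I)).
  rewrite -cardsUI.
  have -> : [set inl x | x in real_part s] :&: [set inr x | x in ~: orders s] = set0.
    by apply/setP => z; rewrite !inE; apply/negP => /andP[/imsetP[x _ ->] /imsetP[]].
  rewrite cards0 addn0; apply: eq_card => z; rewrite !inE; apply/idP/orP.
    by case: z => [x|i] zs; [left|right]; apply: imset_f; rewrite !inE ?zs.
  by case=> /imsetP[w]; rewrite !inE ?negbK => ws ->.
by rewrite -addnA [#|~: _| + _]addnC cardsC.
Qed.

(** If some flagged door exists, the room has [#|I|] elements and its colors are exactly those other
    than [i0]; one color is repeated, and removing either of its two elements gives the flagged
    doors. *)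
Lemma flags_by_room_even (s : {set T + I}) :
  (room s -> color @: s != setT) -> ~~ odd #|[set z | flag s z]|.
Proof.
move=> hs; have [->|] := eqVneq [set z | flag s z] set0; first by rewrite cards0.
case/set0Pn => z; rewrite inE => /and3P[zs rs /eqP cz].
have cs : color @: s = ~: [set i0].
  have : ~: [set i0] \subset color @: s by rewrite -cz imsetS// subD1set.
  move=> sub; apply/eqP; rewrite eqEsubset sub andbT; apply/subsetP => i ic.
  rewrite !inE; apply: contraNneq (hs rs) => ii0; apply/eqP/setP => j; rewrite [RHS]inE.
  have [->|j0] := eqVneq j i0; first by rewrite -ii0.
  by apply: (subsetP sub); rewrite !inE.
have cardI := cardsC [set i0]; rewrite cards1 in cardI.
have sI : #|s| = #|I|.
  by have := card_real_part s; move: rs => /andP[_ /eqP ->]; lia.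
(* With the single color [i0], the room has one element, which would have no admissible color. *)
have [I1|I2] := posnP #|~: [set i0]|.
  have /cards1P[z' sz] : #|s| == 1 by rewrite sI -cardI I1.
  have : color z' \in color @: s by rewrite sz imset_f// inE.
  by rewrite cs; move/eqP: I1; rewrite cards_eq0 => /eqP->; rewrite inE.
suff -> : [set z | flag s z] = [set z in s | color @: (s :\ z) == ~: [set i0]].
  by rewrite (card_redundant cs)//; rewrite sI -cardI.
by apply/setP => y; rewrite !inE /flag rs.
Qed.

(** The boundary door: no points, and [i0] as its only order. *)
Definition outer : {set T + I} := [set inr i | i in ~: [set i0]].

Lemma color_slack (s : {set T + I}) : real_part s = set0 -> color @: s = ~: orders s.
Proof.
move=> A0; apply/setP => i; rewrite !inE negbK; apply/imsetP/idP; last by exists (inr i).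
case=> [[x|j]] zs ->//; have : x \in real_part s by rewrite inE.
by rewrite A0 inE.
Qed.

(** The rooms behind a door correspond to its redundant orders. There are two of these when the door
    contains a point; a door without points carrying all colors but [i0] is [outer], behind which
    there is one room. *)
Lemma flags_by_door (t : {set T + I}) :
  odd #|[set z | (z \notin t) && flag (z |: t) z]| = (t == outer).
Proof.
have outerA : real_part outer = set0.
  by apply/setP => x; rewrite !inE; apply/negP => /imsetP[].
have outerC : orders outer = [set i0].
  by apply/setP => i; rewrite !inE mem_imset ?inE ?negbK//; exact: inr_inj.
have flagE z : z \notin t -> flag (z |: t) z = room (z |: t) && (color @: t == ~: [set i0]).
  by move=> zt; rewrite /flag setU1K// !inE eqxx.
have outerE : (color @: t == ~: [set i0]) -> real_part t = set0 -> t = outer.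
  move=> /eqP ct A0; move: ct; rewrite color_slack// => /setC_inj Ct.
  apply/setP => -[x|i].
    by have /setP/(_ x) := A0; have /setP/(_ x) := outerA; rewrite !inE => -> ->.
  by have /setP/(_ i) := Ct; have /setP/(_ i) := outerC; rewrite !inE => <- /negb_inj.
have domO : t = outer -> dominant (real_part t) (orders t).
  move=> ->; rewrite outerA outerC; apply/dominantP => y; exists i0; first by rewrite inE.
  by move=> x; rewrite inE.
have colO : t = outer -> color @: t = ~: [set i0].
  by move=> ->; rewrite color_slack// outerC.
have partsl x : real_part (inl x |: t) = x |: real_part t /\ orders (inl x |: t) = orders t.
  split; apply/setP => y; rewrite !inE//=.
have partsr i : real_part (inr i |: t) = real_part t /\ orders (inr i |: t) = orders t :\ i.
  by split; apply/setP => y; rewrite !inE//= negb_or.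
have count : dominant (real_part t) (orders t) -> #|orders t| = #|real_part t|.+1 ->
   color @: t = ~: [set i0] ->
   #|[set z | (z \notin t) && flag (z |: t) z]| = #|redundant (real_part t) (orders t)|.
  move=> dt ct colt; rewrite -card_extends//; apply: eq_card => z; rewrite !inE.
  have [zt|zt] := boolP (z \in t).
    by case: z zt => [x|i] zt /=; rewrite !inE zt.
  rewrite flagE// colt eqxx andbT /room; case: z zt => [x|i] zt /=.
    have [-> ->] := partsl x; rewrite !inE zt /= cardsU1 inE zt ct addSn add0n eqxx andbT//.
  have [-> ->] := partsr i; rewrite !inE zt /=.
  by have := cardsD1 i (orders t); rewrite inE zt ct add1n => -[->]; rewrite eqxx andbT.
have [tO|tO] := eqVneq t outer.
  rewrite count ?colO ?domO// ?tO ?outerA ?outerC ?cards0 ?cards1//.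
  have -> : redundant set0 [set i0] = [set i0].
    apply/setP => i; rewrite !inE; case: eqP => //= ->.
    by rewrite setDv imset0 eqxx.
  by rewrite cards1.
have [->|] := eqVneq [set z | (z \notin t) && flag (z |: t) z] set0; first by rewrite cards0.
case/set0Pn => z; rewrite inE => /andP[zt]; rewrite flagE// => /andP[rz colt].
have [A0|/set0Pn[a aA]] := eqVneq (real_part t) set0.
  by rewrite (outerE colt A0) eqxx in tO.
have [dt ct] : dominant (real_part t) (orders t) /\ #|orders t| = #|real_part t|.+1.
  move: rz => /andP[]; case: z zt => [x|i] zt.
    have [-> ->] := partsl x => d /eqP; rewrite cardsU1 inE zt add1n => <-; split=> //.
    by apply: sub_dominant d => //; exact: subsetUr.
  have [-> ->] := partsr i => d /eqP ->; split; last by rewrite (cardsD1 i) inE zt.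
  by apply: sub_dominant d => //; exact: subD1set.
rewrite count ?(eqP colt)// card_redundant//; first exact: dominant_rank_min aA dt.
by apply/card_gt0P; exists a.
Qed.

(** An incidence is recorded by its room and the element removed, or by its door and the element
    added. *)
Lemma flags_double_count :
  \sum_(s : {set T + I}) #|[set z | flag s z]| =
  \sum_(t : {set T + I}) #|[set z | (z \notin t) && flag (z |: t) z]|.
Proof.
have cardE (P : pred (T + I)) : #|[set z | P z]| = \sum_z P z.
  by rewrite -sum1_card big_mkcond; apply: eq_bigr => z _; rewrite inE; case: (P z).
under eq_bigr => s _ do rewrite cardE.
under [RHS]eq_bigr => s _ do rewrite cardE.
rewrite exchange_big [RHS]exchange_big /=; apply: eq_bigr => z _.
rewrite (bigID (fun s : {set T + I} => z \in s)) /= addnC big1 ?add0n; last first.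
  by move=> s /negbTE zs; rewrite /flag zs.
rewrite [RHS](bigID (fun t : {set T + I} => z \in t)) /= [X in _ = X + _]big1 ?add0n;
  last by move=> t ->.
rewrite (reindex_onto (fun t : {set T + I} => z |: t) (fun s => s :\ z)); last exact: setD1K.
apply: eq_big => [t|t /andP[_ /eqP]].
  rewrite !inE eqxx /=; apply/eqP/idP => [<-|]; first by rewrite !inE eqxx.
  exact: setU1K.
by move=> <-; rewrite !inE eqxx /= setD1K ?inE ?eqxx.
Qed.

(** Without a room of all colors, every room would have an even number of flags, whereas the count
    by doors is odd because of [outer]. *)
Lemma scarf : exists A C, dominant A C /\ C \subset c @: A.
Proof.
have [/existsP[s /andP[/andP[ds _] /eqP cs]]|hn] :=
  boolP [exists s, room s && (color @: s == setT)].
  (* The elements [inr j] of the room only provide colors outside [orders s], so the colors in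
     [orders s] come from points. *)
  exists (real_part s), (orders s); split=> //; apply/subsetP => i; rewrite inE => ins.
  have : i \in color @: s by rewrite cs.
  case/imsetP => -[x|j] zs ij; last by rewrite ij zs in ins.
  by rewrite ij; apply: imset_f; rewrite inE.
have even : ~~ odd (\sum_(s : {set T + I}) #|[set z | flag s z]|).
  apply: (big_ind (fun k => ~~ odd k)) => // [x y|s _];
    first by rewrite oddD => /negbTE-> /negbTE->.
  apply: flags_by_room_even => rs; move: hn; rewrite negb_exists => /forallP/(_ s).
  by rewrite rs.
move: even; rewrite flags_double_count (bigD1 outer)//= oddD flags_by_door eqxx /=.
rewrite negbK; set S := (\sum_(_ | _) _); suff /negbTE-> : ~~ odd S by [].
apply: (big_ind (fun k => ~~ odd k)) => // [x y|t tO];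
  first by rewrite oddD => /negbTE-> /negbTE->.
by rewrite flags_by_door.
Qed.

End Parity.
End Scarf.

(** * Scarf's lemma on the grid points of a simplex *)

Definition grid (m N : nat) := {g : {ffun 'I_m -> 'I_N.+1} | \sum_i (g i : nat) == N}.

Lemma grid_build (m N : nat) (s : 'I_m -> nat) :
  \sum_i s i = N -> exists g : grid m N, forall i, val g i = s i :> nat.
Proof.
move=> sN; have lt i : s i < N.+1 by rewrite -sN ltnS (bigD1 i)//= leq_addr.
pose g : {ffun 'I_m -> 'I_N.+1} := [ffun i => Ordinal (lt i)].
have hg : \sum_i (g i : nat) == N.
  by apply/eqP; rewrite -[RHS]sN; apply: eq_bigr => i _; rewrite ffunE.
by exists (exist _ g hg) => i; rewrite /= ffunE.
Qed.

(** With points ordered by each coordinate, dominance forces the minima of [A] in the coordinates of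
    [C] to add up to more than [N - m]. A point of [A] thus has less than [m] left for exceeding
    these minima and for the coordinates outside [C]. *)
Lemma scarf_grid (m N : nat) (c : grid m N -> 'I_m) : (0 < m)%N ->
  exists (A : {set grid m N}) (C : {set 'I_m}),
    [/\ A != set0, C \subset c @: A,
        forall a a' k, a \in A -> a' \in A -> val a k <= val a' k + m
      & forall a k, a \in A -> k \notin C -> val a k <= m].
Proof.
move=> m0; pose i0 : 'I_m := Ordinal m0.
have [|t0 _] := @grid_build m N (fun i => (i == i0) * N).
  by rewrite (bigD1 i0) //= mul1n big1 ?addn0 // => i /negbTE ->.
(* Compare the [i]-th coordinates first and break ties by enumeration, so that each order is
   injective. *)
pose r (i : 'I_m) (g : grid m N) := (val g i : nat) * #|{: grid m N}| + enum_rank g.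
have r_le i g h : r i g <= r i h -> val g i <= val h i.
  move=> le; rewrite leqNgt; apply/negP => lt; move: le; apply/negP; rewrite -ltnNge.
  apply: (leq_trans _ (leq_addr _ _)); apply: leq_trans (leq_mul lt (leqnn _)).
  by rewrite mulSn [ltnLHS]addnC ltn_add2r ltn_ord.
have r_inj i : injective (r i).
  move=> g h e; have := r_le i g h; have := r_le i h g.
  rewrite e leqnn => /(_ isT) e1 /(_ isT) e2; have eg : val g i = val h i :> nat by lia.
  by move: e; rewrite /r eg => /addnI/ord_inj/enum_rank_inj.
have [A [C [/dominantP dom CA]]] := scarf r_inj t0 c i0.
have [k0 k0C _] := dom t0.
have [a0 a0A _] := imsetP (subsetP CA _ k0C).
exists A, C.
pose u k : grid m N := [arg min_(a < a0 in A) (val a k : nat)].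
have uP k : u k \in A /\ forall a, a \in A -> val (u k) k <= val a k.
  by rewrite /u; case: arg_minnP.
(* Otherwise some grid point exceeds all these minima by at least one, the surplus being put on
   [k0], against dominance. *)
have sumC : N < \sum_(k in C) (val (u k) k).+1.
  rewrite ltnNge; apply/negP => le; set S := \sum_(k in C) _ in le.
  have [|z hz] := @grid_build m N
    (fun k => (if k \in C then (val (u k) k).+1 else 0) + (k == k0) * (N - S)).
    rewrite big_split /= -big_mkcond /= -/S (bigD1 k0) //= eqxx big1; first lia.
    by move=> i /negbTE ->.
  have [i iC hi] := dom z; have [uA _] := uP i.
  by have /r_le := hi _ uA; rewrite hz iC; lia.
have sumCm : \sum_(k in C) (val (u k) k).+1 <= \sum_(k in C) val (u k) k + m.
  under eq_bigr => k _ do rewrite -addn1.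
  by rewrite big_split sum1_card /= leq_add2l -[X in _ <= X]card_ord max_card.
have ltU := leq_trans sumC sumCm; set U := \sum_(k in C) _ in ltU.
have split_sum a : a \in A ->
    N = U + \sum_(k in C) (val a k - val (u k) k) + \sum_(k | k \notin C) val a k.
  move=> aA; rewrite -big_split /= -{1}(eqP (valP a)) (bigID (mem C)) /=; congr (_ + _).
  by apply: eq_bigr => k _; have [_ /(_ _ aA) le] := uP k; rewrite subnKC.
have bound x y p q : N = U + p + q -> x <= y + (p + q) -> x <= y + m by lia.
have small a k : a \in A -> k \notin C -> val a k <= m.
  move=> aA kC; rewrite -[leqRHS]add0n; apply: bound (split_sum a aA) _.
  by rewrite [X in _ + (_ + X)](bigD1 k) //= add0n addnCA leq_addr.
split=> //; first by apply/set0Pn; exists a0.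
move=> a a' k aA a'A; have [kC|kC] := boolP (k \in C); last first.
  by apply: leq_trans (small a k aA kC) _; exact: leq_addl.
have [_ /(_ _ a'A) ua'] := uP k; apply: bound (split_sum a aA) _.
rewrite (bigD1 k) //= -addnA addnA; apply: leq_trans (leq_addr _ _).
by rewrite -leq_subLR leq_sub2l.
Qed.

(* Rado's argument: as long as some [N j0] contains two elements, one of them can be
   removed without violating the hypothesis, since two violating sets would
   contradict submodularity of the size of the neighbourhood. *)
Lemma hall (A B : finType) (N : A -> {set B}) :
  (forall J : {set A}, #|J| <= #|\bigcup_(j in J) N j|) ->
  exists2 s : A -> B, injective s & forall j, s j \in N j.
Proof.
have [k] := ubnP (\sum_j #|N j|); elim: k N => // k IH N.
rewrite ltnS => leN hN.
have [/existsP[j0]|] := boolP [exists j, 1 < #|N j|]; last first.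
  rewrite negb_exists => /forallP le1.
  have N1 j : exists x, N j = [set x].
    apply/cards1P; rewrite eqn_leq leqNgt le1 /=.
    by have := hN [set j]; rewrite cards1 big_set1.
  have {}N1 j : {x | N j == [set x]}.
    by apply: sigW; have [x ->] := N1 j; exists x.
  exists (fun j => sval (N1 j)) => [i j|j]; last first.
    by case: (N1 j) => x /= /eqP->; rewrite inE.
  case: (N1 i) (N1 j) => x /= /eqP Ni [y /= /eqP Nj] xy; apply/eqP/negPn/negP => ij.
  have := hN [set i; j]; rewrite cards2 ij.
  by rewrite bigcup_setU !big_set1 Ni Nj xy setUid cards1.
move=> /card_gt1P[x [y [xN yN xy]]].
pose del z j := if j == j0 then N j :\ z else N j.
have bigdel z (J : {set A}) : j0 \in J ->
    \bigcup_(j in J) del z j = \bigcup_(j in J :\ j0) N j :|: (N j0 :\ z).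
  move=> jJ; rewrite (big_setD1 j0)//= {1}/del eqxx setUC; congr (_ :|: _).
  by apply: eq_bigr => j; rewrite !inE /del => /andP[/negbTE->].
have IHdel z : z \in N j0 -> (forall J : {set A}, #|J| <= #|\bigcup_(j in J) del z j|) ->
    exists2 s : A -> B, injective s & forall j, s j \in N j.
  move=> zN hd; have [|s s_inj sN] := IH (del z) _ hd.
    apply: leq_trans leN; rewrite (bigD1 j0)// [X in _ < X](bigD1 j0)//= /del eqxx.
    rewrite [in X in _ < X](cardsD1 z) zN add1n addSn ltnS leq_add2l.
    by apply: leq_sum => j /negbTE->.
  exists s => // j; have := sN j; rewrite /del; case: eqP => // _.
  by rewrite !inE => /andP[].
have viol z : ~~ [forall J : {set A}, #|J| <= #|\bigcup_(j in J) del z j|] ->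
    exists2 J : {set A}, j0 \notin J & #|\bigcup_(j in J) N j :|: (N j0 :\ z)| <= #|J|.
  rewrite negb_forall => /existsP[J]; rewrite -ltnNge => lt.
  have jJ : j0 \in J.
    apply: contraLR lt => jJ; rewrite -leqNgt; apply: leq_trans (hN J) _.
    rewrite (eq_bigr (del z))// => j jinJ; rewrite /del; case: eqP => // jj.
    by rewrite jj (negbTE jJ) in jinJ.
  exists (J :\ j0); first by rewrite !inE eqxx.
  by rewrite -bigdel// -ltnS; apply: leq_trans lt _; rewrite (cardsD1 j0 J) jJ.
have [/forallP/(IHdel x xN)//|/viol[J1 j1 le1]] :=
  boolP [forall J : {set A}, #|J| <= #|\bigcup_(j in J) del x j|].
have [/forallP/(IHdel y yN)//|/viol[J2 j2 le2]] :=
  boolP [forall J : {set A}, #|J| <= #|\bigcup_(j in J) del y j|].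
exfalso; set X := _ :|: _ in le1; set Y := _ :|: _ in le2.
(* As [x] and [y] differ, [X :|: Y] contains all of [N j0]. The two bounds then give
   [#|J1| + #|J2| + 1 <= #|X| + #|Y|], against [le1] and [le2]. *)
have leU : #|j0 |: (J1 :|: J2)| <= #|X :|: Y|.
  apply: leq_trans (hN _) _; apply/subset_leq_card/bigcupsP => j.
  rewrite !inE => /or3P[/eqP->|jJ|jJ]; apply/subsetP => z zN.
  - rewrite !inE zN !andbT; have [->|] := eqVneq z x; last by rewrite orbT.
    by rewrite xy !orbT.
  - by rewrite !inE; apply/orP; left; apply/orP; left; apply/bigcupP; exists j.
  - by rewrite !inE; apply/orP; right; apply/orP; left; apply/bigcupP; exists j.
have leI : #|J1 :&: J2| <= #|X :&: Y|.
  apply: leq_trans (hN _) _; apply/subset_leq_card/bigcupsP => j.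
  rewrite !inE => /andP[jJ1 jJ2]; apply/subsetP => z zN; rewrite !inE.
  by apply/andP; split; apply/orP; left; apply/bigcupP; exists j.
have := cardsUI X Y; have := cardsUI J1 J2; move: leU; rewrite cardsU1 inE negb_or j1 j2; lia.
Qed.

From HB Require Import structures.
From mathcomp Require Import all_boot all_order all_algebra.
From mathcomp Require Import finmap.
From mathcomp Require Import all_classical all_reals all_analysis.
From mathcomp Require Import lra.
Import Order.TTheory GRing.Theory Num.Theory.
Import numFieldNormedType.Exports.
Local Open Scope classical_set_scope.
Local Open Scope ring_scope.

(** * Brouwer's fixed point theorem *)

Section RealContinuity.
Variables (R : realType) (T : topologicalType).
Implicit Types f g : T -> R.

Lemma continuous_cstr (a : R) : continuous (fun _ : T => a).
Proof. by move=> x; exact: cvg_cst. Qed.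

Lemma continuous_addr f g : continuous f -> continuous g -> continuous (fun x => f x + g x).
Proof. by move=> cf cg x; apply: cvgD; [exact: cf|exact: cg]. Qed.

Lemma continuous_oppr f : continuous f -> continuous (fun x => - f x).
Proof. by move=> cf x; apply: cvgN; exact: cf. Qed.

Lemma continuous_mulr f g : continuous f -> continuous g -> continuous (fun x => f x * g x).
Proof. by move=> cf cg x; apply: cvgM; [exact: cf|exact: cg]. Qed.

Lemma continuous_divr f g : continuous f -> continuous g -> (forall x, g x != 0) ->
  continuous (fun x => f x / g x).
Proof.
by move=> cf cg g0; apply: continuous_mulr => // x; apply: cvgV => //; exact: cg.
Qed.

Lemma continuous_maxr f g : continuous f -> continuous g ->
  continuous (fun x => Num.max (f x) (g x)).
Proof. by move=> cf cg x; apply: continuous_max; [exact: cf|exact: cg]. Qed.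

Lemma continuous_sumr (I : Type) (s : seq I) (P : pred I) (F : I -> T -> R) :
  (forall i, P i -> continuous (F i)) -> continuous (fun x => \sum_(i <- s | P i) F i x).
Proof. by move=> cF; apply: continuous_big => //; exact: add_continuous. Qed.

Lemma continuous_prodr (I : Type) (s : seq I) (P : pred I) (F : I -> T -> R) :
  (forall i, P i -> continuous (F i)) -> continuous (fun x => \prod_(i <- s | P i) F i x).
Proof. by move=> cF; apply: continuous_big => //; exact: mul_continuous. Qed.

End RealContinuity.

Section Brouwer.
Variables (R : realType) (m : nat).

Definition simplex : set 'rV[R]_m :=
  [set y | (forall i, 0 <= y ord0 i) /\ \sum_i y ord0 i = 1].

Lemma simplex_compact : compact simplex.
Proof.
apply: (@subclosed_compact _ _ [set y : 'rV[R]_m | forall i, `[0, 1]%classic (y ord0 i)]).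
- have -> : simplex = (\bigcap_(i : 'I_m) [set y | 0 <= y ord0 i]) `&`
                      [set y | \sum_i y ord0 i = 1].
    by apply/seteqP; split=> y [h1 h2]; split => // i; [move=> _ |]; apply: h1.
  apply: closedI.
    apply: closed_bigI => i _.
    apply: (@preimage_closed _ _ (fun y : 'rV[R]_m => y ord0 i) [set x | 0 <= x]).
      by move=> y _; exact: coord_continuous.
    exact: closed_ge.
  apply: (@preimage_closed _ _ (fun y : 'rV[R]_m => \sum_i y ord0 i) [set x | x = 1]).
    by move=> y _; apply: continuous_sumr => i _; exact: coord_continuous.
  exact: closed_eq.
- by apply: (@rV_compact R m (fun=> `[0, 1]%classic)) => i; exact: segment_compact.
- move=> y [y0 y1] i /=; rewrite in_itv /= y0 -y1 (bigD1 i)//= lerDl.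
  by apply: sumr_ge0.
Qed.

Variable G : 'rV[R]_m -> 'rV[R]_m.
Hypothesis G_cont : forall i, continuous (fun y => G y ord0 i).
Hypothesis G_simplex : forall y, simplex y -> simplex (G y).

(** What Scarf's lemma provides at scale [e]; as [e] tends to 0 it forces [y <= G y] in every
    coordinate. *)
Definition nearly_fixed (e : R) (C : {set 'I_m}) (y : 'rV[R]_m) : Prop :=
  (forall i, i \notin C -> y ord0 i <= e) /\
  (forall i, i \in C -> exists a : 'rV[R]_m, (forall k, `|y ord0 k - a ord0 k| <= e) /\
                                  a ord0 i <= G a ord0 i).

(** Color each grid point by a coordinate that [G] does not decrease; one exists because the
    coordinates sum to 1 before and after. *)
Lemma nearly_fixed_exists (N : nat) : (0 < m)%N ->
  exists C y, simplex y /\ nearly_fixed (m%:R / N.+1%:R) C y.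
Proof.
move=> m0; pose pt (g : grid m N.+1) : 'rV[R]_m := \row_i ((val g i : nat)%:R / N.+1%:R).
have pt_simplex g : simplex (pt g).
  split=> [i|]; first by rewrite mxE divr_ge0.
  under eq_bigr do rewrite mxE.
  by rewrite -mulr_suml -natr_sum (eqP (valP g)) divff// pnatr_eq0.
have hc g : exists i, pt g ord0 i <= G (pt g) ord0 i.
  apply: contrapT => /forallNP h; have [_ s1] := G_simplex (pt_simplex g).
  have [_ s2] := pt_simplex g.
  suff : \sum_i G (pt g) ord0 i < \sum_i pt g ord0 i by rewrite s1 s2 ltxx.
  apply: ltr_sum => [|i _]; first by apply/hasP; exists (Ordinal m0) => //; rewrite mem_index_enum.
  by rewrite ltNge; apply/negP; exact: h.
have [c cP] := choice hc.
have [A [C [/set0Pn[a0 a0A] CA near small]]] := scarf_grid c m0.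
exists C, (pt a0); split; first exact: pt_simplex.
split=> [i iC|i iC].
  by rewrite mxE ler_pM2r ?invr_gt0// ler_nat small.
have /imsetP[a aA ->] := fintype.subsetP CA _ iC; exists (pt a); split; last exact: cP.
move=> k; rewrite !mxE -mulrBl normrM [X in _ * X]gtr0_norm ?invr_gt0//.
rewrite ler_pM2r ?invr_gt0// ler_norml; have := near a0 a k a0A aA; have := near a a0 k aA a0A.
rewrite -!(ler_nat R) !natrD; lra.
Qed.

(** If no point is fixed, each has a neighbourhood free of nearly fixed points for large [N];
    compactness makes [N] uniform, contradicting [nearly_fixed_exists]. *)
Lemma brouwer : (0 < m)%N -> exists2 y, simplex y & G y = y.
Proof.
move=> m0; apply: contrapT => nofix.
have nofixP y : simplex y -> G y <> y by move=> sy Gy; apply: nofix; exists y.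
have /compact_near_coveringP cpt := simplex_compact.
have evt (e : R) : 0 < e -> \forall N \near \oo, m%:R / N.+1%:R < e.
  move=> e0; have e1 : 0 < e / m%:R by rewrite divr_gt0// ltr0n.
  have := near_infty_natSinv_lt (PosNum e1); apply: filterS => N /=.
  by rewrite ltr_pdivlMr ?ltr0n// mulrC.
suff [N _ /(_ N (leqnn N))] : \forall N \near \oo,
    simplex `<=` (fun y => forall C, ~ nearly_fixed (m%:R / N.+1%:R) C y).
  by move=> h; have [C [y [sy /(h _ sy)]]] := nearly_fixed_exists N m0.
apply: (cpt nat \oo (fun N y => forall C, ~ nearly_fixed (m%:R / N.+1%:R) C y)) => y sy.
apply: (@filter_forall _ _ (fun C (p : 'rV[R]_m * nat) =>
  ~ nearly_fixed (m%:R / p.2.+1%:R) C p.1) (nbhs (y, \oo))) => C.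
have [[i iC yi]|small] := pselect (exists2 i, i \notin C & 0 < y ord0 i).
  have y2 : 0 < y ord0 i / 2 by rewrite divr_gt0.
  exists ([set z : 'rV[R]_m | y ord0 i / 2 < z ord0 i], [set N | m%:R / N.+1%:R < y ord0 i / 2]).
    split=> /=; last exact: evt.
    apply: (@cvgr_gt R _ (nbhs y) _ (fun z : 'rV[R]_m => z ord0 i) (y ord0 i)); last lra.
    exact: coord_continuous.
  by move=> [z N] [/= zy Ny] [/(_ i iC) zN _];
    have := le_lt_trans zN (lt_trans Ny zy); rewrite ltxx.
have [[i iC Gi]|big] := pselect (exists2 i, i \in C & G y ord0 i < y ord0 i).
  have : \forall a \near y, 0 < (a : 'rV[R]_m) ord0 i - G a ord0 i.
    apply: (@cvgr_gt R _ (nbhs y) _ (fun y => y ord0 i - G y ord0 i) (y ord0 i - G y ord0 i));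
      last by rewrite subr_gt0.
    apply: (@continuous_addr _ _ (fun y : 'rV[R]_m => y ord0 i) (fun y => - G y ord0 i)).
      exact: coord_continuous.
    by apply: continuous_oppr; exact: G_cont.
  move=> /nbhs_ballP[e /= e0 He]; have e2 : 0 < e / 2 by rewrite divr_gt0.
  exists (ball y (e / 2), [set N | m%:R / N.+1%:R < e / 2]).
    by split=> /=; [exact: nbhsx_ballx | exact: evt].
  move=> [z N] [/= zy Ny] [_ /(_ i iC)[a [za Ga]]].
  have : ball y e a.
    rewrite (splitr e); apply: ball_triangle zy _; split=> // j k; rewrite ord1.
    by rewrite /ball /=; apply: le_lt_trans (za k) Ny.
  by move=> /He /=; rewrite subr_gt0 ltNge Ga.
(* In the remaining case [y <= G y] coordinatewise; both sum to 1, so they are equal. *)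
exfalso; apply: (nofixP y sy); have [Gy0 Gy1] := G_simplex sy; have [y0 y1] := sy.
have yC i : i \notin C -> y ord0 i = 0.
  move=> iC; apply/eqP; rewrite eq_le y0 andbT leNgt; apply/negP => yi.
  by apply: small; exists i.
have le i : y ord0 i <= G y ord0 i.
  have [iC|/yC->//] := boolP (i \in C).
  by rewrite leNgt; apply/negP => Gi; apply: big; exists i.
apply/rowP => i; apply/eqP; rewrite -subr_eq0.
have : \sum_j (G y ord0 j - y ord0 j) == 0 by rewrite sumrB Gy1 y1 subrr.
rewrite psumr_eq0; last by move=> j _; rewrite subr_ge0.
by move=> /allP/(_ i (mem_index_enum i)).
Qed.

End Brouwer.

Lemma continuous_mx (R : realType) (T : topologicalType) (p q : nat) (f : T -> 'M[R]_(p, q)) :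
  (forall i j, continuous (fun t => f t i j)) -> continuous f.
Proof.
move=> cf t; apply/cvg_ballP => e e0.
have : \forall s \near t, forall ij : 'I_p * 'I_q, ball (f t ij.1 ij.2) e (f s ij.1 ij.2).
  apply: (@filter_forall _ _ (fun (ij : 'I_p * 'I_q) s => ball (f t ij.1 ij.2) e (f s ij.1 ij.2))).
  by move=> [i j]; have /cvg_ballP := cf i j t; apply.
by apply: filterS => s h; split=> // i j; exact: h (i, j).
Qed.

Lemma sum_mxvec (R : nmodType) (p q : nat) (A : 'M[R]_(p, q)) :
  \sum_k mxvec A ord0 k = \sum_i \sum_j A i j.
Proof.
rewrite pair_bigA (reindex _ (curry_mxvec_bij p q)) /=.
by apply: eq_bigr => -[i j] _; rewrite mxvecE.
Qed.

(** * Fixed points and balanced points on a product of simplices *)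

Section ProductOfSimplices.
Variables (R : realType) (d n : nat).
Hypotheses (d0 : (0 < d)%N) (n0 : (0 < n)%N).

Definition simplices : set 'M[R]_(d, n) :=
  [set x | forall i, (forall j, 0 <= x i j) /\ \sum_j x i j = 1].

Definition embed (x : 'M[R]_(d, n)) : 'rV[R]_(d * n) := mxvec (d%:R^-1 *: x).

(* A row of total mass [t] less than [1 / d] is completed to mass [1 / d] by adding
   a constant, so that dividing by [max t (1 / d)] always yields row sums [1]. *)
Definition retract (y : 'rV[R]_(d * n)) : 'M[R]_(d, n) :=
  \matrix_(i, j) ((vec_mx y i j + Num.max 0 (d%:R^-1 - \sum_k vec_mx y i k) / n%:R) /
                  Num.max (\sum_k vec_mx y i k) d%:R^-1).

Let dR : 0 < d%:R^-1 :> R. Proof. by rewrite invr_gt0 ltr0n. Qed.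
Let nR : 0 < n%:R :> R. Proof. by rewrite ltr0n. Qed.

Lemma retract_cont i j : continuous (fun y => retract y i j).
Proof.
have vc k : continuous (fun y : 'rV[R]_(d * n) => vec_mx y i k).
  suff -> : (fun y : 'rV[R]_(d * n) => vec_mx y i k) = (fun y => y ord0 (mxvec_index i k)).
    exact: coord_continuous.
  by apply/funext => y; rewrite mxE.
have sc : continuous (fun y : 'rV[R]_(d * n) => \sum_k vec_mx y i k).
  exact: continuous_sumr.
rewrite (_ : (fun _ => _) = fun y : 'rV[R]_(d * n) =>
  (vec_mx y i j + Num.max 0 (d%:R^-1 - \sum_k vec_mx y i k) / n%:R) /
                  Num.max (\sum_k vec_mx y i k) d%:R^-1); last first.
  by apply/funext => y; rewrite mxE.
apply: continuous_divr.
- apply: continuous_addr => //; apply: continuous_mulr; last exact: continuous_cstr.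
  apply: continuous_maxr; first exact: continuous_cstr.
  by apply: continuous_addr; [exact: continuous_cstr|exact: continuous_oppr].
- by apply: continuous_maxr => //; exact: continuous_cstr.
- by move=> y; rewrite gt_eqF// lt_max dR orbT.
Qed.

Lemma retract_simplices y : simplex y -> simplices (retract y).
Proof.
move=> [y0 _] i; have v0 k : 0 <= vec_mx y i k by rewrite mxE.
set t := \sum_k vec_mx y i k.
have m0 : 0 < Num.max t d%:R^-1 by rewrite lt_max dR orbT.
split=> [j|].
  by rewrite mxE divr_ge0 ?(ltW m0)// addr_ge0// divr_ge0 ?(ltW nR)// le_max lexx.
under eq_bigr do rewrite mxE.
rewrite -mulr_suml big_split /= sumr_const card_ord -[X in _ + X]mulr_natr.
rewrite mulfVK ?gt_eqF// -/t.
apply: (mulIf (lt0r_neq0 m0)); rewrite mulfVK ?gt_eqF// mul1r.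
by have [le|/ltW le] := leP t d%:R^-1; [rewrite max_r|rewrite max_l];
  rewrite ?subr_ge0 ?subr_le0//; lra.
Qed.

Lemma embed_simplex x : simplices x -> simplex (embed x).
Proof.
move=> sx; split=> [k|].
  rewrite /embed; case/mxvec_indexP: k => i j; rewrite mxvecE mxE.
  by rewrite mulr_ge0 ?(ltW dR)//; have [-> _] := sx i.
rewrite sum_mxvec; under eq_bigr => i _.
  under eq_bigr do rewrite mxE.
  rewrite -mulr_sumr; have [_ ->] := sx i; over.
by rewrite sumr_const card_ord mulr1 -[LHS]mulr_natr mulVf// pnatr_eq0 -lt0n.
Qed.

Lemma embedK x : simplices x -> retract (embed x) = x.
Proof.
move=> sx; apply/matrixP => i j; rewrite mxE /embed mxvecK.
under eq_bigr do rewrite mxE.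
rewrite -mulr_sumr; have [_ ->] := sx i.
rewrite mulr1 subrr !maxxx mul0r addr0 mxE invrK mulrAC mulVf ?mul1r//.
by rewrite pnatr_eq0 -lt0n.
Qed.

(** Brouwer's theorem is applied to [embed], [F] and [retract] composed, on one simplex with [d * n]
    coordinates. *)
Lemma brouwer_simplices (F : 'M[R]_(d, n) -> 'M[R]_(d, n)) :
  (forall i j, continuous (fun x => F x i j)) ->
  (forall x, simplices x -> simplices (F x)) ->
  exists2 x, simplices x & F x = x.
Proof.
move=> cF sF; have retc : continuous retract by apply: continuous_mx; exact: retract_cont.
have [|||y sy fy] := @brouwer R (d * n)%N (fun y => embed (F (retract y))).
- move=> k; case/mxvec_indexP: k => i j.
  rewrite (_ : (fun _ => _) = fun y => d%:R^-1 * F (retract y) i j); last first.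
    by apply/funext => y; rewrite /embed mxvecE mxE.
  apply: continuous_mulr; first exact: continuous_cstr.
  move=> y.
  by apply: (@continuous_comp _ _ _ retract (fun x => F x i j)); [exact: retc|exact: cF].
- by move=> y sy; apply: embed_simplex; apply: sF; exact: retract_simplices.
- by rewrite muln_gt0 d0.
exists (F (retract y)); first by apply: sF; exact: retract_simplices.
by rewrite -{2}fy embedK//; apply: sF; exact: retract_simplices.
Qed.

(* The map adds to each entry the excess of [Phi] over the row average and
   renormalises; at a fixed point a positive total excess would force a zero entry
   in the row, at which the boundary hypothesis is contradicted. *)
Lemma balanced_point (Phi : 'M[R]_(d, n) -> 'M[R]_(d, n)) :
  (forall i j, continuous (fun x => Phi x i j)) ->
  (forall x i j, simplices x -> 0 <= Phi x i j) ->
  (forall x i j k, simplices x -> x i j = 0 -> n%:R^-1 <= x i k -> Phi x i k = 0) ->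
  exists2 x, simplices x & forall i j, Phi x i j = (\sum_k Phi x i k) / n%:R.
Proof.
move=> cP P0 Pb.
pose ex x i j : R := Num.max 0 (Phi x i j - (\sum_k Phi x i k) / n%:R).
have ex0 x i j : 0 <= ex x i j by rewrite le_max lexx.
have exs0 x i : 0 <= \sum_k ex x i k by apply: sumr_ge0.
have den x i : 0 < 1 + \sum_k ex x i k by rewrite ltr_wpDr.
have cex i j : continuous (fun x => ex x i j).
  apply: continuous_maxr; first exact: continuous_cstr.
  apply: continuous_addr => //; apply: continuous_oppr; apply: continuous_mulr.
    exact: continuous_sumr.
  exact: continuous_cstr.
pose F (x : 'M[R]_(d, n)) : 'M[R]_(d, n) :=
  \matrix_(i, j) ((x i j + ex x i j) / (1 + \sum_k ex x i k)).
have [||x sx Fx] := @brouwer_simplices F.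
- move=> i j.
  rewrite (_ : (fun _ => _) = fun x : 'M[R]_(d, n) =>
    (x i j + ex x i j) / (1 + \sum_k ex x i k)); last by apply/funext => x; rewrite mxE.
  apply: continuous_divr; last by move=> x; rewrite gt_eqF.
    by apply: continuous_addr => //; exact: coord_continuous.
  by apply: continuous_addr; [exact: continuous_cstr | exact: continuous_sumr].
- move=> x sx i; have [x0 x1] := sx i; split=> [j|].
    by rewrite mxE divr_ge0 ?addr_ge0 ?(ltW (den _ _)).
  under eq_bigr do rewrite mxE.
  by rewrite -mulr_suml big_split /= x1 divff// gt_eqF.
exists x => // i; set a := (\sum_k Phi x i k) / n%:R.
have eqx j : x i j * (\sum_k ex x i k) = ex x i j.
  have /matrixP/(_ i j) := Fx; rewrite mxE => /(canRL (mulfVK _)).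
  by rewrite gt_eqF// => /(_ isT); lra.
have sum0 : \sum_j (Phi x i j - a) = 0.
  rewrite sumrB sumr_const card_ord -[a *+ n]mulr_natr /a mulfVK ?subrr//.
  by rewrite gt_eqF.
have [S0|S1] := eqVneq (\sum_k ex x i k) 0.
  have le j : Phi x i j <= a.
    rewrite -subr_le0 leNgt; apply/negP => lt; have := eqx j.
    by rewrite S0 mulr0 /ex -/a max_r ?(ltW lt)// => e; rewrite -e ltxx in lt.
  move=> j; apply/eqP; rewrite eq_sym -subr_eq0.
  have : \sum_j (a - Phi x i j) == 0.
    by under eq_bigr do rewrite -opprB; rewrite sumrN sum0 oppr0.
  rewrite psumr_eq0 => [/allP/(_ j (mem_index_enum j))//|k _].
  by rewrite subr_ge0.
exfalso; have Sp : 0 < \sum_k ex x i k by rewrite lt_def S1 exs0.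
have [x0 x1] := sx i.
have [j xj0] : exists j, x i j = 0.
  apply: contrapT => /forallNP xn0.
  have pos j : 0 < Phi x i j - a.
    have := eqx j; have xp : 0 < x i j by rewrite lt_def x0 andbT; apply/eqP; exact: xn0.
    by have := mulr_gt0 xp Sp => /[swap] ->; rewrite /ex -/a lt_max ltxx.
  have : \sum_j (Phi x i j - a) == 0 by rewrite sum0.
  rewrite psumr_eq0 => [/allP/(_ (Ordinal n0) (mem_index_enum _))|k _]; last exact: ltW.
  by rewrite gt_eqF.
(* At such an entry the boundary hypothesis makes [Phi], hence the excess, vanish; [eqx] then makes
   the entry itself 0. *)
have [k xk] : exists k, n%:R^-1 <= x i k.
  apply: contrapT => /forallNP xn.
  suff : \sum_k x i k < \sum_(k < n) (n%:R^-1 : R).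
    by rewrite x1 sumr_const card_ord -[ltRHS]mulr_natr mulVf ?ltxx// gt_eqF.
  apply: ltr_sum => [|k _]; first by apply/hasP; exists (Ordinal n0); rewrite ?mem_index_enum.
  by rewrite ltNge; apply/negP; exact: xn.
have a0 : 0 <= a by rewrite divr_ge0 ?(ltW nR)//; apply: sumr_ge0 => l _; exact: P0.
have := eqx k; rewrite /ex -/a (Pb x i j k)// sub0r max_l ?oppr_le0// => /eqP.
rewrite mulf_eq0 (negbTE S1) orbF => /eqP xk0; move: xk; rewrite xk0.
by rewrite leNgt invr_gt0 nR.
Qed.
End ProductOfSimplices.

(** * Fractional matchings *)

(** Each [q] is the edge with vertices [(i, sel q i)] of a [d]-partite hypergraph; [u] is a perfect
    fractional matching supported in [S]. *)
Definition fractional_matching (R : realType) (d n : nat) (Q : finType)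
    (sel : Q -> 'I_d -> 'I_n) (S : {set Q}) : Prop :=
  exists u : Q -> R, [/\ forall q, 0 <= u q, forall q, q \notin S -> u q = 0
    & forall i j, \sum_(q | sel q i == j) u q = 1].

Section Matching.
Variables (R : realType) (d n : nat).
Hypotheses (d0 : (0 < d)%N) (n0 : (0 < n)%N).
(** The value [v q x] measures how far the d-cell of [q] at [x] is from lying in its edge. By
    [v_zero] some d-cell fits, and it uses an empty cell in every row that has one. *)
Variables (Q : finType) (sel : Q -> 'I_d -> 'I_n) (v : Q -> 'M[R]_(d, n) -> R).
Hypothesis v_cont : forall q, continuous (v q).
Hypothesis v_ge0 : forall q x, simplices x -> 0 <= v q x.
Hypothesis v_zero : forall x, simplices x -> exists q, v q x = 0 /\
  forall i, (forall k, x i k != 0) \/ x i (sel q i) = 0.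

(** The [q] with [v q x < e] get continuous weights; at a balanced point all cells carry the same
    weight [W / n], so rescaling by [n / W] gives a matching. *)
Lemma approx_matching (e : R) : 0 < e ->
  exists2 x, simplices x & fractional_matching R sel [set q | v q x < e]%SET.
Proof.
move=> e0; have nR : 0 < n%:R :> R by rewrite ltr0n.
(* In a row with a zero entry the product vanishes, so [h] is 0 at entries at least [1 / n], as
   [balanced_point] requires. Yet [h] is positive at zero entries and throughout rows without zeros,
   so by [v_zero] the total weight is positive. *)
pose h (x : 'M[R]_(d, n)) i j : R := \prod_k x i k + Num.max 0 (n%:R^-1 - x i j).
have hc i j : continuous (fun x => h x i j).
  apply: continuous_addr.
    by apply: continuous_prodr => k _; exact: coord_continuous.
  apply: continuous_maxr; first exact: continuous_cstr.
  apply: continuous_addr; first exact: continuous_cstr.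
  by apply: continuous_oppr; exact: coord_continuous.
have h0 x i j : simplices x -> 0 <= h x i j.
  move=> sx; rewrite addr_ge0 ?le_max ?lexx//; apply: prodr_ge0 => k _.
  by have [-> _] := sx i.
pose w q x : R := Num.max 0 (e - v q x) * \prod_i h x i (sel q i).
have w0 q x : simplices x -> 0 <= w q x.
  by move=> sx; rewrite mulr_ge0 ?le_max ?lexx//; apply: prodr_ge0 => i _; exact: h0.
have wc q : continuous (w q).
  apply: continuous_mulr; last by apply: continuous_prodr => i _; exact: hc.
  apply: continuous_maxr; first exact: continuous_cstr.
  by apply: continuous_addr; [exact: continuous_cstr | exact: continuous_oppr].
pose Phi x : 'M[R]_(d, n) := \matrix_(i, j) \sum_(q | sel q i == j) w q x.
have [|||x sx Px] := @balanced_point R d n d0 n0 Phi.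
- move=> i j; rewrite (_ : (fun _ => _) = fun x => \sum_(q | sel q i == j) w q x).
    exact: continuous_sumr.
  by apply/funext => x; rewrite mxE.
- by move=> x i j sx; rewrite mxE; apply: sumr_ge0 => q _; exact: w0.
- move=> x i j k sx xj xk; rewrite mxE big1// => q /eqP qk.
  rewrite /w (bigD1 i)//= /h qk (bigD1 j)//= xj mul0r add0r
    [Num.max 0 (n%:R^-1 - _)]max_l ?mul0r ?mulr0//.
  by rewrite subr_le0.
exists x => //; set W := \sum_q w q x.
have rowW i : \sum_k Phi x i k = W.
  rewrite /W (partition_big (fun q => sel q i) xpredT)//=.
  by apply: eq_bigr => k _; rewrite mxE.
have W0 : 0 < W.
  have [q [vq hq]] := v_zero sx; rewrite /W (bigD1 q)//= ltr_pwDl//.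
    rewrite mulr_gt0 ?lt_max ?vq ?subr0 ?e0 ?orbT//; apply: prodr_gt0 => i _.
    rewrite /h; have [x0 _] := sx i; have [xn0|->] := hq i.
      rewrite ltr_pwDl ?le_max ?lexx//; apply: prodr_gt0 => k _.
      by rewrite lt_def xn0 x0.
    rewrite ltr_wpDl ?prodr_ge0// subr0 lt_max.
    by rewrite invr_gt0 nR orbT.
  by apply: sumr_ge0 => q' _; exact: w0.
exists (fun q => w q x * (n%:R / W)); split=> [q|q|i j].
- by rewrite mulr_ge0 ?w0// divr_ge0 ?ltW.
- by rewrite inE -leNgt => le; rewrite /w max_l ?mul0r// subr_le0.
- have := Px i j; rewrite mxE rowW -mulr_suml => ->.
  by rewrite mulrA mulfVK ?divff// gt_eqF.
Qed.

(** There are finitely many supports [S]. If none worked exactly, the sum of [v] over each matchable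
    [S] would have a positive minimum by compactness, contradicting [approx_matching] for small
    [e]. *)
Lemma exact_matching : exists2 x, simplices x & fractional_matching R sel [set q | v q x == 0]%SET.
Proof.
apply: contrapT => none.
have retc : continuous (@retract R d n) by apply: continuous_mx; exact: retract_cont.
have x0 : simplices (const_mx n%:R^-1 : 'M[R]_(d, n)).
  move=> i; split=> [j|]; first by rewrite mxE invr_ge0.
  under eq_bigr do rewrite mxE.
  by rewrite sumr_const card_ord -[LHS]mulr_natr mulVf// pnatr_eq0 -lt0n.
have gap (S : {set Q}) : exists e : R, 0 < e /\
    (fractional_matching R sel S -> forall x, simplices x -> e <= \sum_(q in S) v q x).
  have [fS|nS] := pselect (fractional_matching R sel S); last by exists 1; split=> // /nS.
  pose g y := \sum_(q in S) v q (retract y).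
  have [|||c /set_mem cs cmin] := @EVT_min_rV R (d * n) g (@simplex R (d * n)).
  - by exists (embed (const_mx n%:R^-1)); exact: embed_simplex.
  - exact: simplex_compact.
  - apply: continuous_subspaceT; apply: continuous_sumr => q _ y.
    by apply: (@continuous_comp _ _ _ (@retract R d n) (v q)); [exact: retc|exact: v_cont].
  have rc := retract_simplices d0 n0 cs.
  exists (g c); split; last first.
    move=> _ x sx; rewrite -{1}(embedK d0 sx); apply: cmin; rewrite inE.
    exact: embed_simplex.
  have g0 : 0 <= g c by apply: sumr_ge0 => q _; exact: v_ge0.
  rewrite lt_def g0 andbT; apply/eqP => gc; apply: none; exists (retract c) => //.
  have [u [u0 uS um]] := fS; exists u; split=> // q.
  rewrite inE => vq; apply: uS; apply: contra vq => qS; move/eqP: gc.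
  rewrite psumr_eq0 => [/allP/(_ q (mem_index_enum q))|r _]; last exact: v_ge0.
  by rewrite qS.
have [del delP] := choice gap.
(* A sum of at most [#|Q|] terms below [e] then stays below every gap. *)
pose e := \big[Num.min/1]_S del S / #|Q|.+1%:R.
have m0 : 0 < \big[Num.min/(1 : R)]_S del S.
  by apply: (big_ind (fun z => 0 < z)) => // [y z y0 z0|S _]; [rewrite lt_min y0|case: (delP S)].
have [|x sx fS] := @approx_matching e; first by rewrite divr_gt0.
have [_ /(_ fS x sx)] := delP [set q | v q x < e]%SET.
apply/negP; rewrite -ltNge; set S := finset _.
have : \sum_(q in S) v q x <= #|Q|%:R * e.
  apply: (@le_trans _ _ (\sum_(q in S) e)).
    by apply: ler_sum => q; rewrite inE => /ltW.
  rewrite sumr_const -[leLHS]mulr_natl ler_wpM2r ?ler_nat ?max_card//.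
  by rewrite divr_ge0// ltW.
move=> /le_lt_trans; apply; apply: (@lt_le_trans _ _ (\big[Num.min/1]_S del S)).
  rewrite /e mulrCA gtr_pMr// ltr_pdivrMr// mul1r ltr_nat//.
by rewrite bigmin_le_cond.
Qed.

End Matching.

(** * Rounding fractional matchings to covers *)

Section Greedy.
Variables (R : realType) (T Q : finType) (cov : Q -> {set T}) (u : Q -> R).
Hypothesis u_ge0 : forall q, 0 <= u q.
Hypothesis u_cover : forall t, \sum_(q | t \in cov q) u q = 1.

(** Each point of [U] has total weight 1, so exchanging sums counts [U] by the weighted sizes of
    [cov q :&: U]. *)
Lemma card_le_weight (k : nat) (U : {set T}) :
  (forall q, u q != 0 -> (#|cov q :&: U| <= k)%N) -> #|U|%:R <= k%:R * \sum_q u q.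
Proof.
move=> hk; have -> : #|U|%:R = \sum_q u q * #|cov q :&: U|%:R.
  rewrite -sum1_card natr_sum.
  under eq_bigr => t _ do rewrite -(u_cover t) big_mkcond.
  rewrite exchange_big /=; apply: eq_bigr => q _.
  rewrite -sum1_card natr_sum mulr_sumr -big_mkcondr /=.
  by apply: eq_big => [t|t _]; rewrite ?inE ?mulr1// andbC.
rewrite mulr_sumr; apply: ler_sum => q _; rewrite mulrC.
have [->|uq] := eqVneq (u q) 0; first by rewrite !mulr0.
by rewrite ler_wpM2r// ler_nat hk.
Qed.

(* Greedy algorithm: while some set still covers [k] new points take it, and then
   pass from [k] to [k - 1]; at that moment at most [(k - 1) * \sum_q u q] points
   remain. *)
Lemma greedy_cover (k : nat) (U : {set T}) :
  (forall q, u q != 0 -> (#|cov q :&: U| <= k)%N) ->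
  exists L : {set Q}, [/\ forall q, q \in L -> u q != 0,
    forall t, t \in U -> exists2 q, q \in L & t \in cov q
    & #|L|%:R <= #|U|%:R / k%:R + (\sum_q u q) * \sum_(1 <= j < k) (j.+1%:R)^-1].
Proof.
have none V : (forall q, u q != 0 -> (#|cov q :&: V| <= 0)%N) -> #|V| = 0%N.
  by move=> /card_le_weight; rewrite mul0r lern0 => /eqP.
elim: k U => [|k IHk] U.
  move=> /none U0; exists finset.set0; split=> [q|t|]; first by rewrite inE.
    by rewrite (cards0_eq U0) inE.
  by rewrite cards0 U0 mul0r big_geq// mulr0 addr0.
have [c] := ubnP #|U|; elim: c U => // c IHc U Uc hU.
have [[q uq qk]|hk] := pselect (exists2 q, u q != 0 & #|cov q :&: U| = k.+1).
  have cU := cardsID (cov q) U; rewrite finset.setIC qk in cU.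
  have [||L [Lu Lc Ll]] := IHc (U :\: cov q)%SET.
  - by move: Uc; rewrite -cU; lia.
  - move=> r ur; apply: leq_trans (hU r ur); apply: subset_leq_card.
    by apply: finset.setIS; exact: finset.subsetDl.
  exists (q |: L)%SET; split=> [r|t tU|].
  - by rewrite !inE => /orP[/eqP->|/Lu].
  - have [tq|tq] := boolP (t \in cov q); first by exists q => //; rewrite !inE eqxx.
    by have [|r rL tr] := Lc t; [rewrite !inE tq|exists r; rewrite // !inE rL orbT].
  - apply: (@le_trans _ _ (1 + #|L|%:R)); first by rewrite cardsU1 natrD lerD2r lern1 leq_b1.
    by rewrite -cU natrD mulrDl divff ?pnatr_eq0// -addrA lerD2l.
have {}hU q : u q != 0 -> (#|cov q :&: U| <= k)%N.
  move=> uq; have := hU q uq; rewrite leq_eqVlt ltnS => /orP[/eqP qk|//].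
  by exfalso; apply: hk; exists q.
have [L [Lu Lc Ll]] := IHk U hU; exists L; split=> //; apply: le_trans Ll _.
case: k {IHk IHc hk} hU => [|k] hU; first by rewrite (none _ hU) !mul0r !big_geq.
(* With [W] the total weight, what remains is [#|U| / (k + 1) <= (#|U| + W) / (k + 2)], that is
   [#|U| <= (k + 1) * W]. *)
rewrite [in leRHS]big_nat_recr//= mulrDr addrCA [leLHS]addrC lerD2l.
have k1 : 0 < k.+1%:R :> R by rewrite ltr0n.
have k2 : 0 < k.+2%:R :> R by rewrite ltr0n.
rewrite -mulrDl ler_pdivrMr// mulrAC ler_pdivlMr//.
have := card_le_weight hU; rewrite -[k.+2%:R]natr1 mulrDl mulrDr mulr1 [_ * k.+1%:R]mulrC.
lra.
Qed.

End Greedy.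

(** Telescoping: [ln (1 + x) <= x] at [x = - 1 / (d + 2)] bounds [1 / (d + 2)] by
    [ln (d + 2) - ln (d + 1)]. *)
Lemma harmonic_le_ln (R : realType) (d : nat) : (0 < d)%N ->
  \sum_(1 <= j < d) (j.+1%:R)^-1 <= ln (d%:R : R).
Proof.
case: d => // d _; elim: d => [|d IH]; first by rewrite big_geq// ln1.
rewrite big_nat_recr//=.
have e : 1 + - d.+2%:R^-1 = d.+1%:R / d.+2%:R :> R.
  apply: (mulIf (lt0r_neq0 (ltr0Sn R d.+1))).
  by rewrite mulrBl mul1r mulVf ?pnatr_eq0// mulfVK ?pnatr_eq0// -[d.+2%:R]natr1 addrK.
have lt1 : -1 < - d.+2%:R^-1 :> R by rewrite ltrN2 invf_lt1 ?ltr0n// ltr1n.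
have := le_ln1Dx lt1; rewrite e ln_div ?posrE ?ltr0n//.
move=> h; apply: (@le_trans _ _ (ln d.+1%:R + d.+2%:R^-1)); first by rewrite lerD2r.
move: h; move: (ln _) (ln _) (_^-1) => p q x; lra.
Qed.

(** The greedy bound with [k = d], for [d * n] cells and total weight [n]. *)
Lemma integral_cover (R : realType) (d n : nat) (Q : finType) (sel : Q -> 'I_d -> 'I_n)
    (S : {set Q}) : (0 < d)%N -> fractional_matching R sel S ->
  exists L : {set Q}, [/\ L \subset S, forall i j, exists2 q, q \in L & sel q i = j
    & #|L|%:R <= (1 + ln (d%:R : R)) * n%:R].
Proof.
move=> d0 [u [u0 uS um]].
pose cov q : {set 'I_d * 'I_n} := [set ij | sel q ij.1 == ij.2]%SET.
have covP i j q : ((i, j) \in cov q) = (sel q i == j) by rewrite inE.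
have ucov t : \sum_(q | t \in cov q) u q = 1.
  case: t => i j; rewrite -(um i j); apply: eq_bigl => q; exact: covP.
have sumu : \sum_q u q = n%:R.
  rewrite (partition_big (fun q => sel q (Ordinal d0)) xpredT)//=.
  by rewrite (eq_bigr (fun=> 1)) => [|j _]; [rewrite sumr_const card_ord|exact: um].
have card_cov q : (#|cov q| <= d)%N.
  rewrite -[X in (_ <= X)%N]card_ord -(card_imset predT (f := fun i => (i, sel q i))).
    apply: subset_leq_card; apply/fintype.subsetP => -[i j]; rewrite covP => /eqP <-.
    exact: imset_f.
  by move=> i i' [].
have [|L [Lu Lc Ll]] := @greedy_cover R _ _ cov u u0 ucov d [set: 'I_d * 'I_n]%SET.
  by move=> q _; rewrite finset.setIT.
exists L; split.
- by apply/fintype.subsetP => q /Lu; apply: contraNT => /uS ->.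
- by move=> i j; have [|q qL] := Lc (i, j); [rewrite inE|rewrite covP => /eqP; exists q].
- apply: le_trans Ll _; rewrite sumu cardsT card_prod !card_ord natrM mulrAC
    divff ?pnatr_eq0 -?lt0n//.
  by rewrite mul1r [leRHS]mulrC mulrDr mulr1 lerD2l ler_wpM2l ?harmonic_le_ln.
Qed.

(** Hall's condition holds because the weight at the cells [J] of the first copy all goes to the
    neighbours of [J], each of weight 1. The resulting injection is a bijection, so both copies are
    covered. *)
Lemma integral_cover2 (R : realType) (n : nat) (Q : finType) (sel : Q -> 'I_2 -> 'I_n)
    (S : {set Q}) : fractional_matching R sel S ->
  exists L : {set Q}, [/\ L \subset S, forall i j, exists2 q, q \in L & sel q i = j
    & (#|L| <= n)%N].
Proof.
move=> [u [u0 uS um]]; pose i1 : 'I_2 := lift ord0 ord0.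
pose N j := [set k | [exists q in S, (sel q ord0 == j) && (sel q i1 == k)]]%SET.
have mass i (K : {set 'I_n}) : #|K|%:R = \sum_(q | sel q i \in K) u q.
  rewrite (partition_big (fun q => sel q i) (mem K))//= -sum1_card natr_sum.
  apply: eq_bigr => k kK; rewrite -(um i k); apply: eq_bigl => q.
  by case: eqP => [->|]; rewrite ?kK ?andbF.
have [J|s s_inj sN] := @hall _ _ N.
  rewrite -(ler_nat R) (mass ord0) (mass i1) big_mkcond [leRHS]big_mkcond /=.
  apply: ler_sum => q _; case: ifP => [qJ|_]; last by case: ifP.
  have [qS|/uS->] := boolP (q \in S); last by case: ifP.
  suff -> : sel q i1 \in (\bigcup_(j in J) N j)%SET by [].
  by apply/finset.bigcupP; exists (sel q ord0); rewrite // inE;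
    apply/exists_inP; exists q; rewrite ?eqxx.
have qP j : exists q, [/\ q \in S, sel q ord0 = j & sel q i1 = s j].
  by have := sN j; rewrite inE => /exists_inP[q qS /andP[/eqP ? /eqP ?]]; exists q.
have [q {}qP] := choice qP.
exists [set q j | j : 'I_n]%SET; split.
- by apply/fintype.subsetP => _ /imsetP[j _ ->]; have [] := qP j.
- move=> i j; have [i0|i0] := eqVneq i ord0.
    by exists (q j); [exact: imset_f|rewrite i0; have [] := qP j].
  have -> : i = i1 by apply/val_inj; case: i i0 => -[|[|]].
  have [t _ ts] := injF_bij s_inj.
  by exists (q (t j)); [exact: imset_f|have [_ _ ->] := qP (t j); rewrite ts].
- by apply: leq_trans (leq_imset_card _ _) _; rewrite card_ord.
Qed.

(** * Partitions and edges *)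

Section Cells.
Variables (R : realType) (n : nat).
Implicit Types c : npartition R n.

Definition cell_left c (j : 'I_n) : R := c (widen_ord (leqnSn n) j).
Definition cell_right c (j : 'I_n) : R := c (lift ord0 j).

Lemma cell_left_le_right c j : cell_left c j <= cell_right c j.
Proof. by apply: cutpt_le; rewrite /= /bump /= add1n. Qed.

(** A cell of positive length contains points arbitrarily close to both ends, and a cell of length 0
    is empty. *)
Lemma cell_subP c j (a b : R) :
  cell c j `<=` `[a, b] <-> cell_right c j = cell_left c j \/
    (a <= cell_left c j /\ cell_right c j <= b).
Proof.
have le := cell_left_le_right c j; split=> [sub|].
  have [->|ne] := eqVneq (cell_right c j) (cell_left c j); first by left.
  have lt : cell_left c j < cell_right c j by rewrite lt_def ne.
  have inside t : cell_left c j < t -> t < cell_right c j -> a <= t <= b.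
    move=> h1 h2; have /sub : cell c j t by split; apply: lteifS.
    by rewrite /= in_itv.
  right; split; rewrite leNgt; apply/negP => h.
    have [ah|ha] := leP a (cell_right c j).
      by have /andP[] := inside ((cell_left c j + a) / 2) ltac:(lra) ltac:(lra); lra.
    by have /andP[] := inside ((cell_left c j + cell_right c j) / 2) ltac:(lra) ltac:(lra); lra.
  have [bl|lb] := leP (cell_left c j) b.
    by have /andP[] := inside ((b + cell_right c j) / 2) ltac:(lra) ltac:(lra); lra.
  by have /andP[] := inside ((cell_left c j + cell_right c j) / 2) ltac:(lra) ltac:(lra); lra.
move=> h x [xlo xhi]; case: h => [e|[al hb]]; last first.
  by rewrite /= in_itv /= (le_trans al (lteifW xlo)) (le_trans (lteifW xhi) hb).
(* A cell closed at both ends is the only one, and then has length 1; any other cell of length 0 is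
   open at one end. *)
exfalso; rewrite -/(cell_left c j) in xlo; rewrite -/(cell_right c j) e in xhi.
case: (eqVneq (j : nat) 0%N) xlo => [j0|_] /= xlo; last first.
  by have := lt_le_trans xlo (lteifW xhi); rewrite ltxx.
case: (eqVneq j.+1 n) xhi => [jn|_] /= xhi; last by have := le_lt_trans xlo xhi; rewrite ltxx.
have : cell_right c j = cell_left c j by [].
have -> : cell_right c j = 1.
  by rewrite -(cutpt_last c); congr (c _); apply/val_inj; rewrite /= /bump /= add1n.
have -> : cell_left c j = 0 by rewrite -(cutpt_first c); congr (c _); apply/val_inj.
by move/eqP; rewrite oner_eq0.
Qed.

(** A cut point may lie in no cell, but the closures of the nondegenerate cells cover [[0, 1]], and
    a closed edge containing such a cell contains its closure. *)
Lemma exists_cell c x : 0 <= x <= 1 ->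
  exists j, cell_left c j < cell_right c j /\ cell_left c j <= x <= cell_right c j.
Proof.
(* The first cut point beyond [x] ends the cell; the alternative [1 <= c k] serves [x = 1]. *)
move=> /andP[x0 x1]; pose P (k : 'I_n.+1) := (x < c k) || (1 <= c k).
have Pmax : P ord_max by rewrite /P cutpt_last lexx orbT.
case: (arg_minnP (fun k : 'I_n.+1 => k : nat) Pmax) => k Pk kmin.
have k0 : (0 < k)%N.
  rewrite lt0n; apply/negP => /eqP k0; have k00 : k = ord0 by apply/val_inj.
  by move: Pk; rewrite /P k00 cutpt_first ltNge x0 ler10.
have kn : (k.-1 < n)%N by have := ltn_ord k; lia.
pose j := Ordinal kn.
have hik : cell_right c j = c k.
  by congr (c _); apply/val_inj; rewrite /= /bump /= add1n prednK.
have : ~~ P (widen_ord (leqnSn n) j).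
  by apply/negP => /kmin /=; lia.
rewrite /P negb_or -leNgt -ltNge -/(cell_left c j) => /andP[lx l1].
exists j; rewrite hik lx /=; case/orP: Pk => [xk|k1].
  by split; [exact: le_lt_trans xk|exact: ltW].
by split; [exact: lt_le_trans k1|exact: le_trans k1].
Qed.

End Cells.

Lemma copy_sub (R : realType) (d : nat) (i : 'I_d) (A : set R) (a b : 'I_d -> R) :
  copy i A `<=` \bigcup_(k in setT) copy k `[a k, b k] <-> A `<=` `[a i, b i].
Proof.
split=> sub.
  move=> x Ax; have [|k _ [/= ik]] := sub (i, x); first by split.
  by rewrite -ik.
by move=> [k x] [/= -> Ax]; exists i => //; split=> //; exact: sub.
Qed.

Lemma dcell_sub (R : realType) (d n : nat) (P : 'I_d -> npartition R n) (f : 'I_d -> 'I_n)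
    (e : set ('I_d * R)) :
  dcell P f `<=` e <-> forall i, copy i (cell (P i) (f i)) `<=` e.
Proof.
split=> [sub i x ix|sub x [i _ ix]]; last exact: sub ix.
by apply: sub; exists i.
Qed.

Lemma cells_in_edges_covers (R : realType) (d n : nat) (H : dinterval_hypergraph R d)
    (P : 'I_d -> npartition R n) (E0 : {fset set ('I_d * R)}) :
  (E0 `<=` edges H)%fset -> cells_in_edges P E0 -> covers E0.
Proof.
move=> sub cov; apply/seteqP; split=> [p [e /= eE0]|[i x] [k _ [/= -> ]]].
  have [a [b [ab ->]]] := edges_dinterval (fsubsetP sub _ eE0).
  move=> [i _ [pi]]; rewrite /= in_itv /= => /andP[h1 h2]; exists i => //; split=> //.
  have [a0 _ b1] := ab i.
  by rewrite /= in_itv /= (le_trans a0 h1) (le_trans h2 b1).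
rewrite /= in_itv /= => /(exists_cell (P k))[j [lt /andP[h1 h2]]].
have [e eE0 ce] := cov k j; exists e => //.
have [a [b [_ eE]]] := edges_dinterval (fsubsetP sub _ eE0).
move: ce; rewrite eE copy_sub cell_subP => -[hl|[al hb]]; first by rewrite hl ltxx in lt.
by exists k => //; split=> //=; rewrite in_itv /= (le_trans al h1) (le_trans h2 hb).
Qed.

Lemma edge_covering_number_le (R : realType) (d : nat) (H : dinterval_hypergraph R d)
    (E0 : {fset set ('I_d * R)}) (r : R) :
  (E0 `<=` edges H)%fset -> covers E0 -> (#|` E0|)%:R <= r ->
  (edge_covering_number H <= r%:E)%E.
Proof.
move=> sub cov le; apply: (@le_trans _ _ (#|` E0|%:R)%:E); last by rewrite lee_fin.
by apply: ereal_inf_lbound; exists E0.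
Qed.

(** * From the covering hypothesis to partitions and edges *)

Section Assembly.
Variables (R : realType) (d n : nat) (H : dinterval_hypergraph R d).
Hypotheses (hd : (1 <= d)%N) (hn : (1 <= n)%N).
Hypothesis hH : forall P : 'I_d -> npartition R n,
     exists (f : 'I_d -> 'I_n) (e : set ('I_d * R)),
       e \in edges H /\ dcell P f `<=` e.

Definition cut (x : 'M[R]_(d, n)) i (k : 'I_n.+1) : R := \sum_(j < n | (j < k)%N) x i j.

Lemma cut_first x i : cut x i ord0 = 0.
Proof. by rewrite /cut big_pred0. Qed.

Lemma cut_last x i : simplices x -> cut x i ord_max = 1.
Proof.
move=> sx; have [_ <-] := sx i; rewrite /cut; apply: eq_bigl => j; exact: ltn_ord.
Qed.

Lemma cut_le x i (j k : 'I_n.+1) : simplices x -> (j <= k)%N -> cut x i j <= cut x i k.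
Proof.
move=> sx jk; rewrite /cut [leRHS](bigID (fun l : 'I_n => (l < j)%N)) /=.
rewrite [X in _ <= X + _](eq_bigl (fun l : 'I_n => (l < j)%N)) => [|l]; last by lia.
by rewrite lerDl; apply: sumr_ge0 => l _; have [-> _] := sx i.
Qed.

Definition partition_of x (sx : simplices x) i : npartition R n :=
  NPartition (cut_first x i) (cut_last i sx) (fun j k => @cut_le x i j k sx).

Lemma partition_of_length x (sx : simplices x) i j :
  cell_right (partition_of sx i) j = cell_left (partition_of sx i) j + x i j.
Proof.
rewrite /cell_right /cell_left /= /cut (bigD1 j) /=; last by rewrite /bump /= add1n.
by rewrite addrC; congr (_ + _); apply: eq_bigl => k; rewrite /bump -val_eqE /=; lia.
Qed.

Lemma exists_interval_ends : exists ab : edges H -> ('I_d -> R) * ('I_d -> R),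
  forall e, val e = \bigcup_(i in setT) copy i `[(ab e).1 i, (ab e).2 i].
Proof.
have ex (e : edges H) : exists ab : ('I_d -> R) * ('I_d -> R),
    val e = \bigcup_(i in setT) copy i `[ab.1 i, ab.2 i].
  by have [a [b [_ eE]]] := edges_dinterval (valP e); exists (a, b).
by have [ab abE] := choice ex; exists ab.
Qed.

Definition selection : finType := (edges H * {ffun 'I_d -> 'I_n})%type.

Lemma partition_with_matching : exists (P : 'I_d -> npartition R n) (S : {set selection}),
  fractional_matching R (fun q : selection => q.2 : 'I_d -> 'I_n) S /\
  forall q, q \in S -> dcell P q.2 `<=` val q.1.
Proof.
have [ab abE] := exists_interval_ends.
(* The overhang of the cell on both sides of the edge; in [v] it is multiplied by the length of the
   cell, so that an empty cell counts as contained. *)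
pose defect (q : selection) i x : R :=
  Num.max 0 ((ab q.1).1 i - cut x i (widen_ord (leqnSn n) (q.2 i))) +
  Num.max 0 (cut x i (lift ord0 (q.2 i)) - (ab q.1).2 i).
have defect0 q i x : 0 <= defect q i x by rewrite addr_ge0// le_max lexx.
pose v (q : selection) (x : 'M[R]_(d, n)) : R := \sum_i x i (q.2 i) * defect q i x.
have vP q x (sx : simplices x) : v q x = 0 <-> dcell (partition_of sx) q.2 `<=` val q.1.
  have defectP i : defect q i x = 0 <->
      (ab q.1).1 i <= cell_left (partition_of sx i) (q.2 i) /\
      cell_right (partition_of sx i) (q.2 i) <= (ab q.1).2 i.
    rewrite /defect; have max0 (z : R) : Num.max 0 z = 0 <-> z <= 0.
      by split=> [<-|z0]; [rewrite le_max lexx orbT|rewrite max_l].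
    split=> [/eqP|[h1 h2]].
      rewrite paddr_eq0 ?le_max ?lexx// => /andP[/eqP/max0 + /eqP/max0].
      by rewrite !subr_le0.
    by rewrite !max_l ?addr0// subr_le0.
  have zeroP i : x i (q.2 i) * defect q i x = 0 <->
      copy i (cell (partition_of sx i) (q.2 i)) `<=` val q.1.
    rewrite abE copy_sub cell_subP -defectP partition_of_length; split.
      by move=> /eqP; rewrite mulf_eq0 => /orP[/eqP->|/eqP]; [left; rewrite addr0|right].
    case=> [/eqP|->]; last by rewrite mulr0.
    by rewrite -subr_eq0 addrAC subrr add0r => /eqP->; rewrite mul0r.
  rewrite dcell_sub; split=> [v0 i|sub].
    apply/zeroP/eqP; move/eqP: v0; rewrite psumr_eq0 => [|k _].
      by move=> /allP/(_ i (mem_index_enum i)).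
    by rewrite mulr_ge0//; have [-> _] := sx k.
  by rewrite /v big1// => i _; apply/zeroP; exact: sub.
have cutc i k : continuous (fun x => cut x i k).
  by apply: continuous_sumr => j _; exact: coord_continuous.
have [|||x sx fm] := @exact_matching R d n hd hn selection (fun q => q.2 : 'I_d -> 'I_n) v.
- move=> q; apply: continuous_sumr => i _; apply: continuous_mulr.
    exact: coord_continuous.
  apply: continuous_addr; apply: continuous_maxr; try exact: continuous_cstr.
    apply: continuous_addr; first exact: continuous_cstr.
    by apply: continuous_oppr; exact: cutc.
  by apply: continuous_addr; [exact: cutc|exact: continuous_cstr].
- by move=> q x sx; apply: sumr_ge0 => i _; rewrite mulr_ge0//; have [-> _] := sx i.
- move=> x sx; have [f [e [eH fe]]] := hH (partition_of sx).
  (* An empty cell replaces the given one in each copy that has one; the d-cell still lies in the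
     edge [e]. *)
  pose f' : {ffun 'I_d -> 'I_n} := [ffun i => odflt (f i) [pick k | x i k == 0]].
  have f'P i : (forall k, x i k != 0) /\ f' i = f i \/ x i (f' i) = 0.
    rewrite ffunE; case: pickP => [k /eqP|h]; first by right.
    by left; split=> // k; rewrite h.
  exists ([` eH]%fset, f'); split; last by move=> i; have [[]|] := f'P i; [left|right].
  apply/(vP _ _ sx)/dcell_sub => i.
  change (copy i (cell (partition_of sx i) (f' i)) `<=` val [` eH]%fset).
  have [[_ ->]|x0] := f'P i.
    by move/dcell_sub : fe; apply.
  rewrite abE copy_sub cell_subP partition_of_length x0 addr0.
  by left.
exists (partition_of sx), [set q | v q x == 0]%SET; split=> // q.
by rewrite inE => /eqP/vP.
Qed.

Lemma partition_of_cover (L : {set selection}) (P : 'I_d -> npartition R n) :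
  (forall q, q \in L -> dcell P q.2 `<=` val q.1) ->
  (forall i j, exists2 q : selection, q \in L & q.2 i = j) ->
  exists E0 : {fset set ('I_d * R)},
    [/\ (E0 `<=` edges H)%fset, (#|` E0| <= #|L|)%N & cells_in_edges P E0].
Proof.
move=> LP Lc; exists [fset val q.1 | q in L]%fset; split.
- by apply/fsubsetP => _ /imfsetP[q _ ->]; exact: valP.
- by rewrite cardE; exact: leq_imfset_card.
- move=> i j; have [q qL <-] := Lc i j; exists (val q.1); first by apply/imfsetP; exists q.
  by move/dcell_sub : (LP q qL); apply.
Qed.

End Assembly.

Theorem theorem1p6 (R : realType) (d n : nat) (H : dinterval_hypergraph R d)
  (hd : (1 <= d)%N) (hn : (1 <= n)%N)
  (hH : forall P : 'I_d -> npartition R n,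
     exists (f : 'I_d -> 'I_n) (e : set ('I_d * R)),
       e \in edges H /\ dcell P f `<=` e) :
  [/\ exists (P : 'I_d -> npartition R n) (E0 : {fset set ('I_d * R)}),
        [/\ (E0 `<=` edges H)%fset,
            (#|` E0|)%:R <= (1 + ln (d%:R : R)) * n%:R
          & cells_in_edges P E0],
      (edge_covering_number H <= ((1 + ln (d%:R : R)) * n%:R)%:E)%E
    & d = 2%N ->
        (exists (P : 'I_d -> npartition R n) (E0 : {fset set ('I_d * R)}),
          [/\ (E0 `<=` edges H)%fset,
              (#|` E0| <= n)%N
            & cells_in_edges P E0]) /\
        (edge_covering_number H <= (n%:R)%:E)%E].
Proof.
have [P [S [fm SP]]] := partition_with_matching hd hn hH.
have [L [LS Lc Ll]] := integral_cover hd fm.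
have [E0 [E0H E0L E0P]] := partition_of_cover (fun q qL => SP q (fintype.subsetP LS q qL)) Lc.
have E0n : (#|` E0|)%:R <= (1 + ln (d%:R : R)) * n%:R.
  by apply: le_trans Ll; rewrite ler_nat.
split; first by exists P, E0.
  by apply: edge_covering_number_le E0n => //; exact: cells_in_edges_covers E0H E0P.
(* For [d = 2] the same partition and fractional matching are kept; only the rounding changes. *)
move=> d2; move: d2 H hd hH P S fm SP {L LS Lc Ll E0 E0H E0L E0P E0n} => ->.
move=> H hd hH P S fm SP; have [L [LS Lc Ll]] := integral_cover2 fm.
have [E0 [E0H E0L E0P]] := partition_of_cover (fun q qL => SP q (fintype.subsetP LS q qL)) Lc.
have E0n := leq_trans E0L Ll; split; first by exists P, E0.
apply: (@edge_covering_number_le _ _ _ E0) => //; first exact: cells_in_edges_covers E0H E0P.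
by rewrite ler_nat.
Qed.
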